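(* Let $K$ be a field, $S=K[x_1,\ldots,x_r]$, let $I$ be a monomial ideal of $S$ with $I\neq S$, and let $J:=(I,x_1y,\ldots,x_ry)$, an ideal of $R:=S[y]=K[x_1,\ldots,x_r,y]$. Let $n\geq 1$. (1) If $i\geq 2$, then $a_i(R/J^n)=\max\{a_i(S/I^{n-t})+t: 0\leq t\leq n-1\}$. (2) If $I[j]\neq S[j]$ for some $j\in\{1,\ldots,r\}$, then $$a_1(R/J^n)=\max\big(\{2n-2\}\cup\{a_1(S/I^{n-t})+t: 0\leq t\leq n-1\}\big).$$
   Context: $S$ and $R$ are standard graded (all variables of degree 1) with maximal homogeneous ideals $\mathfrak m=(x_1,\ldots,x_r)$ and $\mathfrak n=(x_1,\ldots,x_r,y)$. For a finitely generated graded module $M$ over a standard graded polynomial ring, $a_i(M):=\max\{t: H^i(M)_t\neq 0\}$, where $H^i(M)$ is the $i$-th local cohomology module of $M$ with support in the maximal homogeneous ideal ($\mathfrak m$ for $S$-modules, $\mathfrak n$ for $R$-modules), and $\max\emptyset=-\infty$. For $j\in\{1,\ldots,r\}$, $S[j]:=K[x_i: 1\leq i\leq r,\ i\neq j]$, and $I[j]\subseteq S[j]$ (monomial localization) is the image of $I$ under the $K$-algebra homomorphism $S\to S[j]$ sending $x_j\mapsto 1$ and $x_i\mapsto x_i$ for $i\neq j$. *)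

(* Defs.v *)
From HB Require Import structures.
From mathcomp Require Import all_boot all_order all_algebra.
From mathcomp Require Import mpoly.
From mathcomp Require Import boolp constructive_ereal.
From mathcomp Require Import ring.

Set Implicit Arguments.
Unset Strict Implicit.
Unset Printing Implicit Defensive.

Import Order.TTheory GRing.Theory Num.Theory.

Local Open Scope ring_scope.
Local Open Scope quotient_scope.

(* Ideals of a commutative ring.  Unlike [idealr] of ring_quotient.v, the     *)
(* unit ideal is allowed, so that sums, powers, etc. are always defined.      *)

Definition ideal_axiom (P : comNzRingType) (S : P -> bool) : Prop :=
  [/\ S 0, forall f g, S f -> S g -> S (f + g) & forall a f, S f -> S (a * f)].

Record ideal (P : comNzRingType) : Type := Ideal {
  ideal_mem :> {pred P};
  idealP : ideal_axiom ideal_mem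
}.

Section IdealTheory.
Variable P : comNzRingType.

Lemma ideal_zmod_closed (I : ideal P) : zmod_closed I.
Proof.
case: (idealP I) => I0 ID IM; split=> [|f g If Ig]; first exact: I0.
by apply: ID => //; rewrite -mulN1r; apply: IM.
Qed.

HB.instance Definition _ (I : ideal P) :=
  GRing.isZmodClosed.Build P (ideal_mem I) (ideal_zmod_closed I).

Lemma idealM (I : ideal P) a f : f \in I -> a * f \in I.
Proof. by case: (idealP I) => _ _; apply. Qed.

Definition lin_comb (A : P -> Prop) (f : P) : Prop :=
  exists2 s : seq (P * P),
    (forall x, x \in s -> A x.2) & f = \sum_(x <- s) x.1 * x.2.

Lemma ideal_gen_subproof (A : P -> Prop) :
  ideal_axiom (fun f => `[< lin_comb A f >]).
Proof.
split=> [|f g /asboolP[s sA ->] /asboolP[s' sA' ->]|a f /asboolP[s sA ->]];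
  apply/asboolP.
- by exists [::] => //; rewrite big_nil.
- exists (s ++ s'); last by rewrite big_cat.
  by move=> x; rewrite mem_cat => /orP[/sA|/sA'].
- exists [seq (a * x.1, x.2) | x <- s].
    by move=> _ /mapP[x /sA Ax ->].
  by rewrite big_map mulr_sumr; apply: eq_bigr => x _; rewrite mulrA.
Qed.

Definition ideal_gen (A : P -> Prop) : ideal P := Ideal (ideal_gen_subproof A).

Definition ideal_pow (I : ideal P) (n : nat) : ideal P :=
  ideal_gen (fun g => exists2 f : 'I_n -> P,
                        (forall k, f k \in I) & g = \prod_(k < n) f k).

(* The P-module P / I. *)
Definition quotmod (I : ideal P) : Type := {ideal_quot ideal_mem I}.

HB.instance Definition _ (I : ideal P) := GRing.Zmodule.on (quotmod I).

Definition quot_pi (I : ideal P) (f : P) : quotmod I :=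
  \pi_({ideal_quot ideal_mem I}) f.

Lemma quot_piP (I : ideal P) f g :
  reflect (quot_pi I f = quot_pi I g) (f - g \in I).
Proof. by rewrite Quotient.idealrBE; apply: eqP. Qed.

Lemma quot_pi_surj (I : ideal P) (u : quotmod I) : exists f, u = quot_pi I f.
Proof. by exists (repr (u : {ideal_quot ideal_mem I})); rewrite /quot_pi reprK. Qed.

Lemma quot_piD (I : ideal P) f g :
  quot_pi I (f + g) = quot_pi I f + quot_pi I g.
Proof. exact: Quotient.pi_add. Qed.

Definition quot_scale (I : ideal P) (a : P) (u : quotmod I) : quotmod I :=
  quot_pi I (a * repr (u : {ideal_quot ideal_mem I})).

Lemma quot_scaleE (I : ideal P) a f :
  quot_scale a (quot_pi I f) = quot_pi I (a * f).
Proof.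
apply/quot_piP; rewrite -mulrBr; apply: idealM; apply/quot_piP.
by rewrite {1}/quot_pi reprK.
Qed.

Section QuotLmodule.
Variable I : ideal P.

Fact quot_scaleA a b (u : quotmod I) :
  quot_scale a (quot_scale b u) = quot_scale (a * b) u.
Proof.
by have [f ->] := quot_pi_surj u; rewrite !quot_scaleE mulrA.
Qed.

Fact quot_scale1 : left_id 1 (@quot_scale I).
Proof.
by move=> u; have [f ->] := quot_pi_surj u; rewrite quot_scaleE mul1r.
Qed.

Fact quot_scaleDr : right_distributive (@quot_scale I) +%R.
Proof.
move=> a u v; have [f ->] := quot_pi_surj u; have [g ->] := quot_pi_surj v.
by rewrite -quot_piD !quot_scaleE mulrDr quot_piD.
Qed.

Fact quot_scaleDl (u : quotmod I) :
  {morph (@quot_scale I)^~ u : a b / a + b}.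
Proof.
move=> a b; have [f ->] := quot_pi_surj u.
by rewrite !quot_scaleE mulrDl quot_piD.
Qed.

HB.instance Definition _ := GRing.Zmodule_isLmodule.Build P (quotmod I)
  quot_scaleA quot_scale1 quot_scaleDr quot_scaleDl.

End QuotLmodule.

End IdealTheory.

Lemma quot_piZ (P : comNzRingType) (I : ideal P) (a f : P) :
  a *: quot_pi I f = quot_pi I (a * f).
Proof. exact: quot_scaleE. Qed.

(* The localization M_f of a P-module M at (the powers of) f \in P: pairs     *)
(* (m, k), standing for m / f^k, modulo the usual relation.                   *)

Section Localization.
Variables (P : comNzRingType) (M : lmodType P) (f : P).

Definition loc_rel (u v : M * nat) : bool :=
  `[< exists N, f ^+ N *: (f ^+ v.2 *: u.1 - f ^+ u.2 *: v.1) = 0 >].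

Fact loc_rel_equiv : equiv_class_of loc_rel.
Proof.
split.
- by move=> u; apply/asboolP; exists 0; rewrite subrr scaler0.
- have sym u v : loc_rel u v -> loc_rel v u.
    move=> /asboolP[N e]; apply/asboolP; exists N.
    by rewrite -opprB scalerN e oppr0.
  by move=> u v; apply/idP/idP; apply: sym.
- move=> v u w /asboolP[N1 e1] /asboolP[N2 e2]; apply/asboolP.
  exists (N1 + N2 + v.2)%N.
  have -> : f ^+ (N1 + N2 + v.2) *: (f ^+ w.2 *: u.1 - f ^+ u.2 *: w.1) =
     (f ^+ (N2 + w.2)) *: (f ^+ N1 *: (f ^+ v.2 *: u.1 - f ^+ u.2 *: v.1))
   + (f ^+ (N1 + u.2)) *: (f ^+ N2 *: (f ^+ w.2 *: v.1 - f ^+ v.2 *: w.1)).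
    rewrite !scalerBr !scalerA -!exprD addrA.
    set a := _ *: u.1; set b := _ *: w.1.
    rewrite -[_ + _ *: v.1]addrA.
    have -> : (N2 + w.2 + N1 + u.2 = N1 + u.2 + N2 + w.2)%N by ring.
    rewrite addNr addr0 /a /b; congr (_ *: _ - _ *: _); congr (_ ^+ _); ring.
  by rewrite e1 e2 !scaler0 addr0.
Qed.

Canonical loc_equiv := EquivRelPack loc_rel_equiv.
Canonical loc_encModRel := defaultEncModRel loc_rel.

Definition loc : Type := {eq_quot loc_rel}.

HB.instance Definition _ : EqQuotient (M * nat)%type loc_rel loc :=
  EqQuotient.on loc.
HB.instance Definition _ := Choice.on loc.

Definition frac (m : M) (k : nat) : loc := \pi_loc (m, k).

Lemma fracP m k m' k' :
  frac m k = frac m' k' <->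
  exists N, f ^+ N *: (f ^+ k' *: m - f ^+ k *: m') = 0.
Proof.
rewrite /frac; split=> [/eqP|e]; first by rewrite piE => /asboolP.
by apply/eqP; rewrite piE; apply/asboolP.
Qed.

Lemma frac_surj (u : loc) : exists m k, u = frac m k.
Proof. by exists (repr u).1, (repr u).2; rewrite /frac -surjective_pairing reprK. Qed.

Lemma frac_repr (u : loc) : frac (repr u).1 (repr u).2 = u.
Proof. by rewrite /frac -surjective_pairing reprK. Qed.

Definition loc_add (u v : loc) : loc :=
  frac (f ^+ (repr v).2 *: (repr u).1 + f ^+ (repr u).2 *: (repr v).1)
       ((repr u).2 + (repr v).2).

Definition loc_opp (u : loc) : loc := frac (- (repr u).1) (repr u).2.

Lemma loc_addE m k m' k' :
  loc_add (frac m k) (frac m' k') =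
  frac (f ^+ k' *: m + f ^+ k *: m') (k + k').
Proof.
rewrite /loc_add; set u := frac m k; set v := frac m' k'.
have /fracP[N1 e1] := frac_repr u; have /fracP[N2 e2] := frac_repr v.
case: (repr u) e1 => a p /= e1; case: (repr v) e2 => b q /= e2.
apply/fracP; exists (N1 + N2)%N.
have -> : f ^+ (N1 + N2) *:
    (f ^+ (k + k') *: (f ^+ q *: a + f ^+ p *: b) -
     f ^+ (p + q) *: (f ^+ k' *: m + f ^+ k *: m')) =
    f ^+ (N2 + k' + q) *: (f ^+ N1 *: (f ^+ k *: a - f ^+ p *: m)) +
    f ^+ (N1 + k + p) *: (f ^+ N2 *: (f ^+ k' *: b - f ^+ q *: m')).
  rewrite !(scalerBr, scalerDr, scalerA) -!exprD !opprD addrACA.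
  by congr (_ *: _ - _ *: _ + (_ *: _ - _ *: _)); congr (_ ^+ _); ring.
by rewrite e1 e2 !scaler0 addr0.
Qed.

Lemma loc_oppE m k : loc_opp (frac m k) = frac (- m) k.
Proof.
rewrite /loc_opp; set u := frac m k; have /fracP[N e] := frac_repr u.
apply/fracP; exists N.
by rewrite !scalerN -opprD scalerN e oppr0.
Qed.

Fact loc_addA : associative loc_add.
Proof.
move=> u v w; have [m [k ->]] := frac_surj u; have [m' [k' ->]] := frac_surj v.
have [m'' [k'' ->]] := frac_surj w; rewrite !loc_addE addnA; congr frac.
rewrite !(scalerDr, scalerA) -!exprD addrA; congr (_ *: _ + _ *: _ + _ *: _);
  by congr (_ ^+ _); ring.
Qed.

Fact loc_addC : commutative loc_add.
Proof.
move=> u v; have [m [k ->]] := frac_surj u; have [m' [k' ->]] := frac_surj v.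
by rewrite !loc_addE addnC addrC.
Qed.

Fact loc_add0 : left_id (frac 0 0) loc_add.
Proof.
move=> u; have [m [k ->]] := frac_surj u.
by rewrite loc_addE scaler0 add0r expr0 scale1r.
Qed.

Fact loc_addN : left_inverse (frac 0 0) loc_opp loc_add.
Proof.
move=> u; have [m [k ->]] := frac_surj u; rewrite loc_oppE loc_addE.
by apply/fracP; exists 0; rewrite scalerN addNr !scaler0 subrr scaler0.
Qed.

HB.instance Definition _ :=
  GRing.isZmodule.Build loc loc_addA loc_addC loc_add0 loc_addN.

Lemma frac0 : frac 0 0 = 0. Proof. by []. Qed.

Lemma fracD m k m' k' :
  frac m k + frac m' k' = frac (f ^+ k' *: m + f ^+ k *: m') (k + k').
Proof. exact: loc_addE. Qed.

Lemma fracN m k : - frac m k = frac (- m) k.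
Proof. exact: loc_oppE. Qed.

End Localization.

(* The canonical map M_f -> M_h, m / f^k |-> g^k m / h^k, when h = g * f.     *)
Definition loc_map (P : comNzRingType) (M : lmodType P) (f g h : P)
    (u : loc M f) : loc M h :=
  frac h (g ^+ (repr u).2 *: (repr u).1) (repr u).2.

Lemma loc_mapE (P : comNzRingType) (M : lmodType P) (f g h : P) :
  h = g * f -> forall (m : M) k,
  loc_map g h (frac f m k) = frac h (g ^+ k *: m) k.
Proof.
move=> -> m k; rewrite /loc_map; set u := frac f m k.
have /fracP[N e] := frac_repr u; apply/fracP; exists N.
case: (repr u) e => a p /= e.
have -> : (g * f) ^+ N *: ((g * f) ^+ k *: (g ^+ p *: a) -
    (g * f) ^+ p *: (g ^+ k *: m)) =
    g ^+ (N + k + p) *: (f ^+ N *: (f ^+ k *: a - f ^+ p *: m)).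
  rewrite !(scalerBr, scalerA) !exprMn !exprD.
  by congr (_ *: _ - _ *: _); ring.
by rewrite e scaler0.
Qed.

(* Local cohomology with support in (x_1, ..., x_n) of a graded module M over *)
(* K[x_1, ..., x_n], as the cohomology of the Cech complex                    *)
(*   C^i = \bigoplus_(F : #|F| = i) M_(x_F),    x_F = \prod_(i in F) x_i.     *)
(* [gr t] is the component of degree t of M.                                  *)

Section LocalCohomology.
Variables (K : fieldType) (n : nat) (M : lmodType {mpoly K[n]}).
Variable gr : int -> M -> Prop.

Definition xprod (F : {set 'I_n}) : {mpoly K[n]} := \prod_(i in F) 'X_i.

(* A cochain of degree i is given by its values on the F with #|F| = i; the   *)
(* other values are irrelevant.                                               *)
Definition cochain : Type := forall F : {set 'I_n}, loc M (xprod F).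

Definition cech_diff (c : cochain) : cochain := fun G =>
  \sum_(j in G) (loc_map 'X_j (xprod G) (c (G :\ j)))
                  *~ (-1) ^+ #|[set k in G | (k < j)%N]|.

(* x_F has degree #|F|. *)
Definition loc_gr (F : {set 'I_n}) (t : int) (u : loc M (xprod F)) : Prop :=
  exists m k, gr (t + (k * #|F|)%N%:Z) m /\ u = frac (xprod F) m k.

Definition homog_cochain (i : nat) (t : int) (c : cochain) : Prop :=
  forall F : {set 'I_n}, #|F| = i -> loc_gr t (c F).

Definition cocycle (i : nat) (c : cochain) : Prop :=
  forall G : {set 'I_n}, #|G| = i.+1 -> cech_diff c G = 0.

(* c is the coboundary of an element of degree t of C^(i-1), where C^(-1) = 0 *)
Definition coboundary (i : nat) (t : int) (c : cochain) : Prop :=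
  exists b : cochain,
    (forall E : {set 'I_n}, #|E|.+1 = i -> loc_gr t (b E)) /\
    (forall F : {set 'I_n}, #|F| = i -> c F = cech_diff b F).

(* H^i(M)_t <> 0 *)
Definition loc_coh_neq0 (i : nat) (t : int) : Prop :=
  exists c : cochain,
    [/\ homog_cochain i t c, cocycle i c & ~ coboundary i t c].

End LocalCohomology.

(* The maximum of a set of integers, with max set0 = -oo; a set which is not  *)
(* bounded above gets +oo.                                                    *)
Definition zmax (A : int -> Prop) : \bar int :=
  match pselect (exists a, A a /\ forall b, A b -> b <= a) with
  | left h => (projT1 (cid h))%:E
  | right _ => if `[< exists a, A a >] then +oo%E else -oo%E
  end.

Lemma zmax_maxE (A : int -> Prop) a :
  A a -> (forall b, A b -> b <= a) -> zmax A = a%:E.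
Proof.
move=> Aa ub; rewrite /zmax; case: pselect => [h|]; last by case; exists a.
case: (cid h) => b [Ab ubb] /=; congr (_%:E).
by apply/eqP; rewrite eq_le ub // ubb.
Qed.

Lemma zmax_set0E (A : int -> Prop) : (forall a, ~ A a) -> zmax A = -oo%E.
Proof.
move=> A0; rewrite /zmax; case: pselect => [[a [/A0]]//|_].
by case: asboolP => // -[a /A0].
Qed.

Definition a_invariant (K : fieldType) (n : nat) (M : lmodType {mpoly K[n]})
    (gr : int -> M -> Prop) (i : nat) : \bar int :=
  zmax (loc_coh_neq0 gr i).

(* f is homogeneous of degree t (in particular f = 0 if t < 0). *)
Definition homog_poly (K : fieldType) (n : nat) (t : int)
    (f : {mpoly K[n]}) : Prop :=
  forall m, m \in msupp f -> (mdeg m)%:Z = t.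

Definition quot_gr (K : fieldType) (n : nat) (I : ideal {mpoly K[n]})
    (t : int) (u : quotmod I) : Prop :=
  exists2 f, homog_poly t f & u = quot_pi I f.

(* a_i(K[x_1, ..., x_n] / I) *)
Definition a_quot (K : fieldType) (n : nat) (i : nat)
    (I : ideal {mpoly K[n]}) : \bar int :=
  a_invariant (@quot_gr K n I) i.

Section MonomialIdeals.
Variables (K : fieldType) (r : nat).

Definition monomial_ideal (I : ideal {mpoly K[r]}) : Prop :=
  exists A : 'X_{1..r} -> Prop,
    I =i ideal_gen (fun f => exists2 m, A m & f = 'X_[m]).

(* J = (I, x_1 y, ..., x_r y) in K[x_1, ..., x_r, y], where y is the last     *)
(* variable.                                                                  *)
Definition idealJ (I : ideal {mpoly K[r]}) : ideal {mpoly K[r.+1]} :=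
  ideal_gen (fun g => (exists2 f, f \in I & g = mwiden f) \/
                      (exists i : 'I_r, g = mwiden 'X_i * 'X_ord_max)).

(* S -> S[j], x_j |-> 1, x_i |-> x_i for i != j; the variables of S[j] are    *)
(* indexed by 'I_r.-1 through [lift j].                                       *)
Definition subst1 (j : 'I_r) (f : {mpoly K[r]}) : {mpoly K[r.-1]} :=
  f \mPo [tuple (if unlift j i is Some k then 'X_k else 1) | i < r].

Definition monomial_loc (I : ideal {mpoly K[r]}) (j : 'I_r)
    (g : {mpoly K[r.-1]}) : Prop :=
  exists2 f, f \in I & g = subst1 j f.

End MonomialIdeals.

(* Main.v *)
Require Import Defs.
From HB Require Import structures.
From mathcomp Require Import all_boot all_order all_algebra.
From mathcomp Require Import mpoly.
From mathcomp Require Import boolp constructive_ereal.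
From mathcomp Require Import zify.

Set Implicit Arguments.
Unset Strict Implicit.
Unset Printing Implicit Defensive.

Import Order.TTheory GRing.Theory Num.Theory.

Local Open Scope ring_scope.

Local Notation frac := Defs.frac.

(** Everything is graded by exponent vectors, so the Cech complex of a monomial
    quotient K[x_1, ..., x_n] / L splits into one finite complex of K-vector
    spaces per exponent [a] in Z^n: in degree [i] it has one copy of K for each
    _face_, that is, each set [F] of cardinal [i] such that x^a is nonzero in
    the localization of the quotient at x_F.  Hence the degree [t] part of the
    [i]-th local cohomology is nonzero iff this finite complex has cohomology
    in degree [i] for some [a] of total degree [t] ([cech_multigraded]).

    It remains to compare faces.  Write (a, b) for an exponent of R, with [b]
    the exponent of y.  For b <= n, the coefficient ideal of y^b in J^n is
    m^b I^(n - b); it is m^n for b >= n.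
    - Let [F] be a nonempty set of x-variables.  The ideal m becomes the unit
      ideal in the localization at x_F, so [F] is a face of J^n at (a, b) iff
      0 <= b < n and [F] is a face of I^(n - b) at [a] ([face_lift],
      [face_drop], [comb_I_of_J]).
    - J^n contains a power of x_j y for every [j], so no face contains y
      together with another variable ([face_y_card]).  The singleton {y} is a
      face iff x^a is a monomial outside m^n ([face_y_bounds], [face_small]).
    - For the empty set there can be a discrepancy only when x^a lies in
      I^(n - b), and then I^(n - b) has no face at all at [a]
      ([face_J_set0]).
    So for 0 <= b < n the cohomology of I^(n - b) at [a] embeds in that of J^n
    at (a, b) in all degrees [i >= 1] ([comb_J_of_I]), with equality for
    [i >= 2], and also for [i = 1] if {y} is not a face ([comb_I_of_J]).
    The y-exponent [b] shifts the total degree, and becomes the index [t] of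
    the maximum in the theorem.

    When [i = 1] and {y} is a face, |a| <= n - 1; and b <= n - 1 too, since
    otherwise {} and {y} are the only faces and they cancel.  So this
    contributes only in total degrees <= 2n - 2 ([comb1_degree_le]).  If
    I[j] <> S[j], then no power of x_j lies in I ([subst1_surj]) and degree
    2n - 2 is attained at (a, b) = ((n - 1) e_j, n - 1): there {}, {y} and
    {x_j} are faces, and no face joins y to another variable
    ([comb1_top]). *)

(** * Suprema of sets of integers *)

Lemma exists_int_max (A : int -> Prop) a0 b :
  A a0 -> (forall a, A a -> a <= b) -> exists a, A a /\ forall c, A c -> c <= a.
Proof.
move=> Aa0 Ab.
have ex : exists k : nat, `[< A (b - k%:Z) >].
  exists `|b - a0|%N; apply/asboolP; have := Ab _ Aa0.
  by move=> le; rewrite gez0_abs ?subr_ge0 // opprB addrCA subrr addr0.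
case: (ex_minnP ex) => k /asboolP Ak kmin; exists (b - k%:Z); split=> // c Ac.
have := kmin `|b - c|%N; have := Ab c Ac => cb.
rewrite gez0_abs ?subr_ge0 // opprB addrCA subrr addr0 => /(_ (asboolT Ac)).
lia.
Qed.

(** The defining property of a supremum, which is how [zmax] is used below; it
    covers empty and unbounded sets as well. *)
Lemma zmax_leP (A : int -> Prop) (x : \bar int) :
  (zmax A <= x)%E <-> forall a, A a -> (a%:E <= x)%E.
Proof.
split=> [h a Aa|h].
  apply: le_trans h; rewrite /zmax; case: pselect => [m|nm].
    by case: (cid m) => c [Ac cA] /=; rewrite lee_fin cA.
  by case: asboolP => [_|[]]; [rewrite leey | exists a].
rewrite /zmax; case: pselect => [m|nm].
  by case: (cid m) => c [Ac cA] /=; apply: h.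
case: asboolP => [[a Aa]|_]; last by rewrite leNye.
case: x h => [b h|//|h]; last by have := h a Aa.
case: nm; apply: (exists_int_max Aa (b := b)) => c /h; by rewrite lee_fin.
Qed.

Lemma zmax_ub (A : int -> Prop) a : A a -> (a%:E <= zmax A)%E.
Proof. by move: a; apply/zmax_leP. Qed.

Lemma zmax_ext (A B : int -> Prop) : (forall a, A a <-> B a) -> zmax A = zmax B.
Proof. by move=> AB; congr zmax; apply/funext => a; apply/propext. Qed.

Lemma zmax_shift (B : int -> Prop) (t : int) :
  zmax (fun d => B (d - t)) = (zmax B + t%:E)%E.
Proof.
apply/eqP; rewrite eq_le; apply/andP; split.
  apply/zmax_leP => a /zmax_ub; rewrite EFinB => h.
  by rewrite -leeBlDr.
rewrite -leeBrDr //; apply/zmax_leP => a Ba; rewrite leeBrDr // -EFinD.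
by apply: zmax_ub; rewrite addrK.
Qed.

Lemma zmax_bigU n (B : 'I_n -> int -> Prop) :
  zmax (fun d => exists t, B t d) = \big[maxe/-oo%E]_(t < n) zmax (B t).
Proof.
apply/eqP; rewrite eq_le; apply/andP; split.
  apply/zmax_leP => a [t Bta]; apply: le_trans (zmax_ub Bta) _.
  by rewrite (bigD1 t) //= le_max lexx.
elim/big_ind: _ => [|x z|t _]; first by rewrite leNye.
  by rewrite ge_max => -> ->.
by apply/zmax_leP => a Bta; apply: zmax_ub; exists t.
Qed.

(** * Monomial ideals and their powers *)

Section GeneratedIdeals.
Variables (K : fieldType) (n : nat).
Local Notation P := {mpoly K[n]}.
Implicit Types (A : P -> Prop) (B : 'X_{1..n} -> Prop) (I : ideal P).

(** The form in which _monomial ideal_ is used: membership is decided monomial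
    by monomial. *)
Definition monomial_closed (I : ideal P) :=
  forall f m, f \in I -> m \in msupp f -> 'X_[m] \in I.

Lemma monomial_closed_mem (I : ideal P) f :
  (forall m, m \in msupp f -> 'X_[m] \in I) -> f \in I.
Proof.
move=> fI; rewrite (mpolyE f) big_seq; apply: rpred_sum => m mf.
by rewrite -mul_mpolyC idealM // fI.
Qed.

Lemma ideal_gen_mem A g : A g -> g \in ideal_gen A.
Proof.
move=> Ag; apply/asboolP; exists [:: (1, g)]; last by rewrite big_seq1 mul1r.
by move=> x; rewrite inE => /eqP ->.
Qed.

(** This is how ideals are bounded from above: multiplying a generator by a
    polynomial only increases exponents. *)
Lemma ideal_gen_supp A B :
  (forall m m', B m -> B (m + m')%MM) ->
  (forall g m, A g -> m \in msupp g -> B m) ->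
  forall f m, f \in ideal_gen A -> m \in msupp f -> B m.
Proof.
move=> Bup AB f m /asboolP[s sA ->] /msupp_sum_le /flattenP[_ /mapP[x + ->]].
rewrite filter_predT => /sA xA /msuppM_le /allpairsP[[m1 m2] /= [_ m2x ->]].
by rewrite addmC; apply: Bup; apply: AB m2x.
Qed.

Lemma monomial_closed_gen A :
  (forall g m, A g -> m \in msupp g -> 'X_[m] \in ideal_gen A) ->
  monomial_closed (ideal_gen A).
Proof.
move=> AX; apply: ideal_gen_supp AX => m1 m2 m1A.
by rewrite mpolyXD mulrC idealM.
Qed.

Lemma monomial_ideal_closed I : monomial_ideal I -> monomial_closed I.
Proof.
move=> [A IA] f m; rewrite !IA; apply: monomial_closed_gen => g m' [m0 Am0 ->].
by rewrite msuppX inE => /eqP ->; apply: ideal_gen_mem; exists m0.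
Qed.

Lemma ideal_full I f : 1 \in I -> f \in I.
Proof. by move=> I1; rewrite -[f]mulr1 idealM. Qed.

Lemma ideal_pow0 I f : f \in ideal_pow I 0.
Proof.
apply: ideal_full; apply: ideal_gen_mem; exists (fun=> 0); first by case.
by rewrite big_ord0.
Qed.

Lemma ideal_powS I k f g :
  f \in I -> g \in ideal_pow I k -> f * g \in ideal_pow I k.+1.
Proof.
move=> fI /asboolP[s sA ->]; rewrite mulr_sumr big_seq.
apply: rpred_sum => x /sA [h hI ->].
rewrite mulrCA; apply: idealM; apply: ideal_gen_mem.
exists (fun j => if unlift ord0 j is Some j' then h j' else f).
  by move=> j; case: unliftP.
rewrite big_ord_recl unlift_none; congr (_ * _).
by apply: eq_bigr => j _; rewrite liftK.
Qed.

(** [ideal_gen_supp] for powers: induction on the number of factors. *)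
Lemma ideal_pow_supp I (B : nat -> 'X_{1..n} -> Prop) :
  (forall k m m', B k m -> B k (m + m')%MM) -> (forall m, B 0%N m) ->
  (forall f k m m', f \in I -> m \in msupp f -> B k m' -> B k.+1 (m + m')%MM) ->
  forall k f m, f \in ideal_pow I k -> m \in msupp f -> B k m.
Proof.
move=> Bup B0 BS k; apply: ideal_gen_supp => [m m'|g m [h hI ->{g}]].
  exact: Bup.
elim: k h hI m => [//|k IH] h hI m.
rewrite big_ord_recl => /msuppM_le /allpairsP[[m1 m2] /= [m1h m2h ->]].
apply: BS m1h _ => //; apply: IH m2h => j; exact: hI.
Qed.

Lemma monomial_closed_pow I k :
  monomial_closed I -> monomial_closed (ideal_pow I k).
Proof.
move=> I_mon; apply: (@ideal_pow_supp I (fun k m => 'X_[m] \in ideal_pow I k)).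
- by move=> k' m m' h; rewrite mpolyXD mulrC idealM.
- by move=> m; apply: ideal_pow0.
- by move=> f k' m m' /I_mon fI /fI mI m'I; rewrite mpolyXD ideal_powS.
Qed.

Lemma ideal_powW I k l m : monomial_closed I -> (l <= k)%N ->
  'X_[m] \in ideal_pow I k -> 'X_[m] \in ideal_pow I l.
Proof.
move=> I_mon lk mk; apply: (@ideal_pow_supp I (fun k m =>
  forall l, (l <= k)%N -> 'X_[m] \in ideal_pow I l) _ _ _ k 'X_[m]) => //.
- by move=> k' m1 m2 h l' /h h'; rewrite mpolyXD mulrC idealM.
- by move=> m' l'; rewrite leqn0 => /eqP ->; apply: ideal_pow0.
- move=> f k' m1 m2 /I_mon fI /fI m1I h [|l'] l'k; first exact: ideal_pow0.
  by rewrite mpolyXD ideal_powS ?h.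
- by rewrite msuppX mem_head.
Qed.

End GeneratedIdeals.

(** * Monomials of the powers of J *)

Section IdealJ.
Variables (K : fieldType) (r : nat) (I : ideal {mpoly K[r]}).
Hypothesis I_mon : monomial_closed I.
Local Notation J := (idealJ I).
Implicit Types (m p : 'X_{1..r}) (M : 'X_{1..r.+1}).
Local Notation widen := (widen_ord (leqnSn r)).

Definition mres M : 'X_{1..r} := [multinom M (widen i) | i < r].

Lemma mresD M M' : mres (M + M') = (mres M + mres M')%MM.
Proof. by apply/mnmP=> i; rewrite mnmDE !mnmE. Qed.

Lemma mres_widen m : mres (mnmwiden m) = m.
Proof. by apply/mnmP=> i; rewrite mnmE mnmwiden_widen. Qed.

Lemma mresE M : M = (mnmwiden (mres M) + U_(ord_max) *+ M ord_max)%MM.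
Proof.
apply/mnmP=> i; rewrite mnmDE mulmnE mnm1E.
case: (unliftP ord_max i) => [j ->|->]; last first.
  by rewrite mnmwiden_ordmax eqxx mul1n.
have -> : lift ord_max j = widen j.
  by apply: val_inj; rewrite /= /bump leqNgt ltn_ord.
rewrite mnmwiden_widen mnmE [_ == _]negbTE ?mul0n ?addn0 //.
by rewrite -val_eqE /= gtn_eqF.
Qed.

Lemma msupp_mwiden (f : {mpoly K[r]}) M :
  M \in msupp (mwiden f) -> exists2 m, m \in msupp f & M = mnmwiden m.
Proof.
rewrite {1}(mpolyE f) raddf_sum => /msupp_sum_le /flattenP[_ /mapP[m + ->]].
rewrite filter_predT => mf /=; rewrite mwidenZ mwidenX => /msuppZ_le.
by rewrite msuppX inE => /eqP ->; exists m.
Qed.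

Lemma mwiden_idealJ f : f \in I -> mwiden f \in J.
Proof. by move=> fI; apply: ideal_gen_mem; left; exists f. Qed.

Lemma XiY_idealJ i : 'X_[U_(widen i) + U_(ord_max)] \in J.
Proof.
by apply: ideal_gen_mem; right; exists i; rewrite mpolyXD mwidenX mnmwiden1.
Qed.

Lemma monomial_closed_idealJ : monomial_closed J.
Proof.
apply: monomial_closed_gen => g M [[f fI ->] /msupp_mwiden[m mf ->]|[i ->]].
  by rewrite -mwidenX mwiden_idealJ // (I_mon fI).
rewrite mwidenX mnmwiden1 -mpolyXD msuppX inE => /eqP ->; exact: XiY_idealJ.
Qed.

Lemma idealJ_supp f M : f \in J -> M \in msupp f ->
  'X_[mres M] \in I \/ (0 < M ord_max)%N /\ (0 < mdeg (mres M))%N.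
Proof.
move: f M; apply: ideal_gen_supp => [M M' [h|[h1 h2]]|g M].
- by left; rewrite mresD mpolyXD mulrC idealM.
- by right; rewrite mresD mdegD mnmDE; lia.
- move=> [[f fI ->] /msupp_mwiden[m mf ->]|[i ->]].
    by left; rewrite mres_widen (I_mon fI).
  rewrite mwidenX mnmwiden1 -mpolyXD msuppX inE => /eqP ->; right.
  by rewrite mresD mdegD -mnmwiden1 mres_widen mdeg1 mnmDE mnm1E eqxx addn1.
Qed.

(** In a product of [n] monomials of J, each factor that is not divisible by a
    monomial of I involves y, so at least [n - M ord_max] factors are divisible
    by a monomial of I. *)
Lemma Jpow_res n M :
  'X_[M] \in ideal_pow J n -> 'X_[mres M] \in ideal_pow I (n - M ord_max).
Proof.
move=> h; apply: (@ideal_pow_supp _ _ J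
  (fun k M => 'X_[mres M] \in ideal_pow I (k - M ord_max)) _ _ _ n 'X_[M] M h).
- move=> k M1 M2 h1; rewrite mresD mpolyXD mulrC idealM //.
  apply: ideal_powW h1 => //.
  by rewrite mnmDE; lia.
- by move=> M'; rewrite sub0n ideal_pow0.
- move=> f k M1 M2 /idealJ_supp fJ /fJ [h1|[h1 _]] h2; rewrite mresD mnmDE.
    apply: (@ideal_powW _ _ _ (k - M2 ord_max).+1) => //; first lia.
    by rewrite mpolyXD ideal_powS.
  by rewrite mpolyXD idealM //; apply: ideal_powW h2 => //; lia.
- by rewrite msuppX mem_head.
Qed.

(** J is contained in mR, as I is proper. *)
Lemma Jpow_mdeg n M : (exists f, f \notin I) ->
  'X_[M] \in ideal_pow J n -> (n <= mdeg (mres M))%N.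
Proof.
move=> [f0 f0I] h; apply: (@ideal_pow_supp _ _ J
  (fun k M => (k <= mdeg (mres M))%N) _ _ _ n 'X_[M] M h).
- by move=> k M1 M2 h1; rewrite mresD mdegD; lia.
- by [].
- move=> f k M1 M2 /idealJ_supp fJ /fJ h1 h2.
  rewrite mresD mdegD -add1n leq_add //.
  case: h1 => [h1|[]//]; rewrite lt0n mdeg_eq0; apply/eqP => e.
  by move: h1; rewrite e mpolyX0 => /ideal_full I1; rewrite I1 in f0I.
- by rewrite msuppX mem_head.
Qed.

Lemma ideal_pow_mwiden k m :
  'X_[m] \in ideal_pow I k -> 'X_[mnmwiden m] \in ideal_pow J k.
Proof.
move=> h; apply: (@ideal_pow_supp _ _ I
  (fun k m => 'X_[mnmwiden m] \in ideal_pow J k) _ _ _ k 'X_[m] m h).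
- by move=> k' m1 m2 h1; rewrite mnmwidenD mpolyXD mulrC idealM.
- by move=> m'; apply: ideal_pow0.
- move=> f k' m1 m2 /I_mon fI /fI m1I h2.
  rewrite mnmwidenD mpolyXD ideal_powS //.
  by rewrite -mwidenX mwiden_idealJ.
- by rewrite msuppX mem_head.
Qed.

(** m^b I^k y^b is contained in J^(b + k): spend the [b] factors y on [b] of the
    variables of x^p, one generator x_i y at a time. *)
Lemma Jpow_mem b k m p M : 'X_[m] \in ideal_pow I k ->
  (b <= mdeg p)%N -> (b <= M ord_max)%N -> mres M = (m + p)%MM ->
  'X_[M] \in ideal_pow J (b + k).
Proof.
elim: b p M => [|b IH] p M mI bp bM eM.
  rewrite (mresE M) eM mnmwidenD -addmA mpolyXD mulrC idealM //.
  exact: ideal_pow_mwiden.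
have [i pi] : exists i, (0 < p i)%N.
  apply: contrapT => np; have : p = 0%MM.
    apply/mnmP=> i; rewrite mnm0E; apply/eqP; rewrite -leqn0 leqNgt.
    by apply/negP => pi; apply: np; exists i.
  by move=> p0; rewrite p0 mdeg0 in bp.
have ep : p = (p - U_(i) + U_(i))%MM by rewrite submK // lep1mP -lt0n.
have le : (U_(widen i) + U_(ord_max) <= M)%MM.
  apply/mnm_lepP => j; rewrite mnmDE !mnm1E.
  have Mi : (0 < M (widen i))%N.
    by have /mnmP/(_ i) := eM; rewrite mnmE mnmDE => ->; lia.
  have ne : ord_max != widen i by rewrite -val_eqE /= gtn_eqF.
  case: (eqVneq (widen i) j) => [<-|_]; first by rewrite (negbTE ne) addn0.
  by case: (eqVneq ord_max j) => [<-|//]; lia.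
rewrite -(submK le) addmC mpolyXD addSn ideal_powS ?XiY_idealJ //.
apply: (IH (p - U_(i))%MM) => //.
- by move: bp; rewrite {1}ep mdegD mdeg1; lia.
- by rewrite !mnmE eqxx -val_eqE /= ltn_eqF //; lia.
apply: (@addIm _ U_(i)%MM) => /=.
rewrite -addmA -ep -eM -[X in _ = mres X](submK le).
rewrite !mresD -[U_(widen i)%MM]mnmwiden1 mres_widen; congr (_ + _)%MM.
apply/mnmP=> j; rewrite mnmDE !mnmE [ord_max == _]negbTE ?addn0 //.
by rewrite -val_eqE /= gtn_eqF.
Qed.

End IdealJ.

(** * The combinatorial Cech complex of a family of faces *)

Section CombinatorialCech.
Variables (K : fieldType) (n : nat).
Implicit Types (p q : {set 'I_n} -> K) (E F G : {set 'I_n}).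

Definition comb_sign G (j : 'I_n) : int :=
  (-1) ^+ #|[set k in G | (k < j)%N]|.

Definition comb_diff p G : K := \sum_(j in G) p (G :\ j) *~ comb_sign G j.

Lemma eq_comb_diff p q G : p =1 q -> comb_diff p G = comb_diff q G.
Proof. by move=> pq; apply: eq_bigr => j _; rewrite pq. Qed.

Lemma comb_diff_set1 q x : comb_diff q [set x] = q set0.
Proof.
rewrite /comb_diff big_set1 setDv /comb_sign.
have -> : [set k in [set x] | (k < x)%N] = set0.
  by apply/setP=> k; rewrite !inE; case: eqP => [->|//]; rewrite ltnn.
by rewrite cards0.
Qed.

(** Cochains are functions on sets that vanish off [D], and the differential is
    truncated to [D].  It squares to zero for the families of faces below,
    because they contain every set that lies between two of their members. *)
Variable D : {set 'I_n} -> Prop.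

Definition comb_bound i p := exists q,
  (forall E, #|E|.+1 = i -> ~ D E -> q E = 0) /\
  (forall F, #|F| = i -> D F -> p F = comb_diff q F).

Definition comb_neq0 i := exists p,
  [/\ forall F, #|F| = i -> ~ D F -> p F = 0,
      forall G, #|G| = i.+1 -> D G -> comb_diff p G = 0 &
      ~ comb_bound i p].

Lemma comb_neq0_empty i : (forall F, ~ D F) -> ~ comb_neq0 i.
Proof.
by move=> D0 [p [_ _ []]]; exists (fun=> 0); split=> // F _ /D0.
Qed.

End CombinatorialCech.

(** * Coefficients at integer exponents *)

Section IntegerExponents.
Variables (K : fieldType) (n : nat).
Implicit Types (f : {mpoly K[n]}) (m : 'X_{1..n}) (v : 'I_n -> int).

(** The coefficient of [f] at an exponent in Z^n, [f] being seen as a Laurent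
    polynomial. *)
Definition zcoef f v : K :=
  if [forall i, 0 <= v i] then f@_[multinom `|v i|%N | i < n] else 0.

Lemma zcoef_mnm f m v : (forall i, (m i)%:Z = v i) -> zcoef f v = f@_m.
Proof.
move=> e; rewrite /zcoef; case: ifP => [_|/negP[]].
  by congr (f@_ _); apply/mnmP=> i; rewrite mnmE -e absz_nat.
by apply/forallP=> i; rewrite -e.
Qed.

Lemma zcoef_neq0 f v : zcoef f v != 0 ->
  exists2 m, m \in msupp f & forall i, (m i)%:Z = v i.
Proof.
rewrite /zcoef; case: ifP => [/forallP v0|]; last by rewrite eqxx.
rewrite -mcoeff_msupp => fm; exists [multinom `|v i|%N | i < n] => // i.
by rewrite mnmE gez0_abs.
Qed.

Lemma zcoefD f g v : zcoef (f + g) v = zcoef f v + zcoef g v.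
Proof. by rewrite /zcoef; case: ifP; rewrite ?mcoeffD ?addr0. Qed.

Lemma zcoefB f g v : zcoef (f - g) v = zcoef f v - zcoef g v.
Proof. by rewrite /zcoef; case: ifP; rewrite ?mcoeffB ?subr0. Qed.

Lemma zcoefMX f m v w : (forall i, w i = v i + (m i)%:Z) ->
  zcoef ('X_[m] * f) w = zcoef f v.
Proof.
move=> vw; rewrite mulrC.
case: (boolP [forall i, 0 <= v i]) => [/forallP v0|v0].
  have ev i : ([multinom `|v i|%N | i < n] i)%:Z = v i by rewrite mnmE gez0_abs.
  rewrite (zcoef_mnm _ ev) -(mcoeffMX f m); apply: zcoef_mnm => i.
  by rewrite vw mnmDE -ev; lia.
rewrite {2}/zcoef (negbTE v0); apply/eqP/negPn/negP => /zcoef_neq0[m' + em'].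
rewrite (perm_mem (msuppMX _ _)) => /mapP[m'' _ e]; case/negP: v0.
apply/forallP=> i; have := em' i; rewrite vw e mnmDE; lia.
Qed.

End IntegerExponents.

(** * The multigraded Cech complex *)

Section Multigraded.
Variables (K : fieldType) (n : nat).
Local Notation P := {mpoly K[n]}.
Implicit Types (F G : {set 'I_n}) (a : {ffun 'I_n -> int}) (m : 'X_{1..n}).

Definition mnm_of_set F : 'X_{1..n} := [multinom ((i \in F) : nat) | i < n].

Lemma xprodX F k : xprod K F ^+ k = 'X_[mnm_of_set F *+ k].
Proof.
rewrite -mpolyXn; congr (_ ^+ _).
rewrite mpolyXE_id /xprod big_mkcond /=; apply: eq_bigr => i _.
by rewrite mnmE; case: ifP.
Qed.

(** The exponent of x^a x_F^k: a numerator of x^a over the denominator x_F^k. *)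
Definition shift a F k (i : 'I_n) : int := a i + (k * (i \in F))%N%:Z.

Lemma shiftD a F k l i :
  shift a F (k + l) i = shift a F k i + ((mnm_of_set F *+ l)%MM i)%:Z.
Proof. by rewrite /shift mulmnE mnmE; case: (i \in F); lia. Qed.

(** x^a is a nonzero element of the localization at x_F of the quotient by I. *)
Definition face (I : ideal P) a F : Prop :=
  (forall i, i \notin F -> 0 <= a i) /\
  (forall N m, (forall i, (m i)%:Z = shift a F N i) -> 'X_[m] \notin I).

Variable I : ideal P.
Hypothesis I_mon : monomial_closed I.
Local Notation M := (quotmod I).
Local Notation gr := (@quot_gr K n I).

Lemma frac_piP F (f g : P) k l :
  frac (xprod K F) (quot_pi I f) k = frac (xprod K F) (quot_pi I g) l <->
  exists N, 'X_[mnm_of_set F *+ N] *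
    ('X_[mnm_of_set F *+ l] * f - 'X_[mnm_of_set F *+ k] * g) \in I.
Proof.
rewrite fracP; split=> -[N h]; exists N.
  rewrite mulrBr; apply/quot_piP; apply: subr0_eq.
  by rewrite -!quot_piZ -!xprodX -scalerBr.
rewrite mulrBr in h; move/quot_piP: h.
by rewrite scalerBr !scalerA !xprodX !quot_piZ -!mulrA => ->; rewrite subrr.
Qed.

Lemma quot_pi0 : quot_pi I 0 = 0.
Proof. by apply: (addrI (quot_pi I 0)); rewrite -quot_piD !addr0. Qed.

Lemma frac_pi_surj F (u : loc M (xprod K F)) :
  exists fk : P * nat, u = frac _ (quot_pi I fk.1) fk.2.
Proof.
have [m [k ->]] := frac_surj u; have [f ->] := quot_pi_surj m.
by exists (f, k).
Qed.

(** The coefficient at x^a of an element of the localization.  Off the faces the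
    coefficient of a numerator depends on the numerator, so it is replaced by 0
    there. *)
Definition lcoef a F (u : loc M (xprod K F)) : K :=
  let fk := projT1 (cid (frac_pi_surj u)) in
  if `[< face I a F >] then zcoef fk.1 (shift a F fk.2) else 0.

Lemma lcoefE a F f k : lcoef a (frac (xprod K F) (quot_pi I f) k) =
  if `[< face I a F >] then zcoef f (shift a F k) else 0.
Proof.
rewrite /lcoef; case: cid => -[g l] /= /frac_piP[N h].
case: asboolP => // -[_ aF]; apply/esym/eqP; rewrite -subr_eq0; apply/eqP.
rewrite -(zcoefMX f (shiftD a F k l)) -(zcoefMX g (shiftD a F l k)).
rewrite [(l + k)%N]addnC -zcoefB -(zcoefMX _ (shiftD a F (k + l) N)).
apply/eqP/negPn/negP => /zcoef_neq0[m /(I_mon h) mI /aF].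
by rewrite mI.
Qed.

Lemma lcoef_nface a F (u : loc M (xprod K F)) : ~ face I a F -> lcoef a u = 0.
Proof. by rewrite /lcoef => naF; case: asboolP. Qed.

Lemma lcoef0 a F : @lcoef a F 0 = 0.
Proof.
rewrite -frac0 -quot_pi0 lcoefE; case: ifP => // _.
by rewrite /zcoef mcoeff0 if_same.
Qed.

Lemma lcoefD a F : {morph @lcoef a F : u v / u + v}.
Proof.
move=> u v; have [[f k] /= ->] := frac_pi_surj u.
have [[g l] /= ->] := frac_pi_surj v.
rewrite fracD !quot_piZ -quot_piD !lcoefE; case: ifP => [_|]; last first.
  by rewrite addr0.
rewrite zcoefD !xprodX; congr (_ + _); first exact: zcoefMX (shiftD _ _ _ _).
by rewrite addnC; apply: zcoefMX (shiftD _ _ _ _).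
Qed.

HB.instance Definition _ a F :=
  GRing.isNmodMorphism.Build (loc M (xprod K F)) K (@lcoef a F)
    (conj (lcoef0 a F) (@lcoefD a F)).

(** If x^a vanishes in the localization, then a power of x_F kills the
    corresponding monomial of the numerator; a common power kills the finitely
    many monomials. *)
Lemma lcoef_inj F (u v : loc M (xprod K F)) :
  (forall a, lcoef a u = lcoef a v) -> u = v.
Proof.
move=> uv; apply/eqP; rewrite -subr_eq0; apply/eqP.
have {uv} : forall a, lcoef a (u - v) = 0.
  by move=> a; rewrite raddfB /= uv subrr.
move: (u - v) => {u v} u; have [[f k] /= ->] := frac_pi_surj u => uv.
rewrite -frac0 -quot_pi0; apply/frac_piP.
have H m : m \in msupp f -> exists N, 'X_[mnm_of_set F *+ N + m] \in I.
  move=> mf; pose a := [ffun i => (m i)%:Z - (k * (i \in F))%N%:Z].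
  have em i : (m i)%:Z = shift a F k i by rewrite /shift ffunE subrK.
  have := uv a; rewrite lcoefE (zcoef_mnm f em); case: asboolP => [_ /eqP|].
    by move: mf; rewrite mcoeff_msupp => /negbTE ->.
  move=> naF _; apply: contrapT => nN; apply: naF; split=> [i iF|N m' em'].
    by rewrite ffunE (negbTE iF) muln0 subr0.
  apply/negP => m'I; apply: nN; exists N.
  have -> : (mnm_of_set F *+ N + m = mnm_of_set F *+ k + m')%MM.
    apply/mnmP=> i; rewrite !mnmDE !mulmnE !mnmE.
    have := em i; have := em' i; rewrite /shift; case: (i \in F); lia.
  by rewrite mpolyXD idealM.
pose Nf m := if pselect (exists N, 'X_[mnm_of_set F *+ N + m] \in I) is left h
  then projT1 (cid h) else 0%N.
exists (\max_(m <- msupp f) Nf m); rewrite mulr0 subr0 mulm0n mpolyX0 mul1r.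
apply: monomial_closed_mem => m; rewrite mulrC (perm_mem (msuppMX _ _)).
case/mapP=> m' m'f ->.
have : 'X_[mnm_of_set F *+ Nf m' + m'] \in I.
  by rewrite /Nf; case: pselect (H _ m'f) => // h _; case: cid.
have := @leq_bigmax_seq _ (msupp f) xpredT Nf m' m'f isT.
set N := \max_(_ <- _) _ => le.
have -> : (mnm_of_set F *+ N + m' =
    mnm_of_set F *+ (N - Nf m') + (mnm_of_set F *+ Nf m' + m'))%MM.
  by apply/mnmP=> i; rewrite !mnmDE !mulmnE addnA -mulnDr subnK.
by move=> ?; rewrite mpolyXD idealM.
Qed.

Lemma card_sum_mem F : #|F| = (\sum_i (i \in F))%N.
Proof.
by rewrite -sum1_card big_mkcond; apply: eq_bigr => i _; case: (i \in F).
Qed.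

Lemma sum_shift a F k :
  \sum_i shift a F k i = \sum_i a i + (k * #|F|)%N%:Z.
Proof.
rewrite big_split /=; congr (_ + _).
by rewrite -(big_morph _ PoszD (erefl _)) -big_distrr /= card_sum_mem.
Qed.

Lemma mdeg_int m : (mdeg m)%:Z = \sum_i (m i)%:Z.
Proof. by rewrite mdegE (big_morph _ PoszD (erefl _)). Qed.

Lemma lcoef_homog a F t (u : loc M (xprod K F)) :
  loc_gr gr t u -> lcoef a u != 0 -> \sum_i a i = t.
Proof.
move=> [w [k [[f hf ->] ->]]]; rewrite lcoefE; case: ifP; last by rewrite eqxx.
move=> _ /zcoef_neq0[m /hf + em].
rewrite mdeg_int (eq_bigr _ (fun i _ => em i)) sum_shift; lia.
Qed.

Lemma homog_polyM_mono t m f :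
  homog_poly t f -> homog_poly (t + (mdeg m)%:Z) ('X_[m] * f : P).
Proof.
move=> hf m'; rewrite mulrC (perm_mem (msuppMX _ _)) => /mapP[m'' /hf <- ->].
by rewrite mdegD addrC.
Qed.

Lemma homog_polyD t f g :
  homog_poly t f -> homog_poly t g -> homog_poly t (f + g : P).
Proof. by move=> hf hg m /msuppD_le; rewrite mem_cat => /orP[/hf|/hg]. Qed.

Lemma mdeg_mnm_of_set F k : mdeg (mnm_of_set F *+ k) = (k * #|F|)%N.
Proof.
rewrite mdegMn mulnC mdegE card_sum_mem; congr (_ * _)%N.
by apply: eq_bigr => i _; rewrite mnmE.
Qed.

Lemma loc_grD F t (u v : loc M (xprod K F)) :
  loc_gr gr t u -> loc_gr gr t v ->
  loc_gr gr t (u + v).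
Proof.
move=> [w [k [[f hf ->] ->]]] [w' [l [[g hg ->] ->]]].
rewrite fracD !quot_piZ -quot_piD.
exists (quot_pi I (xprod K F ^+ l * f + xprod K F ^+ k * g)), (k + l)%N.
split=> //; exists (xprod K F ^+ l * f + xprod K F ^+ k * g) => //.
rewrite !xprodX mulnDl PoszD; apply: homog_polyD.
  by rewrite addrA -[(l * _)%N]mdeg_mnm_of_set; apply: homog_polyM_mono.
rewrite [X in t + X]addrC addrA -[(k * _)%N]mdeg_mnm_of_set.
exact: homog_polyM_mono.
Qed.

Lemma loc_gr0 F t : loc_gr gr t (0 : loc M (xprod K F)).
Proof.
exists 0, 0%N; rewrite frac0; split=> //; exists 0; last by rewrite quot_pi0.
by move=> m; rewrite msupp0.
Qed.

Lemma exists_monomial a F (c : K) : face I a F ->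
  exists2 u : loc M (xprod K F), loc_gr gr (\sum_i a i) u &
    forall a', lcoef a' u = if a' == a then c else 0.
Proof.
move=> aF.
(* x_F to this power is a denominator that clears all negative exponents. *)
pose N := (\sum_i `|a i|)%N.
have aN i : 0 <= shift a F N i.
  rewrite /shift; case: (boolP (i \in F)) => iF; last first.
    by have := proj1 aF i iF; lia.
  have : (`|a i| <= N)%N by rewrite /N (bigD1 i) //= leq_addr.
  lia.
pose m := [multinom `|shift a F N i|%N | i < n].
have em i : (m i)%:Z = shift a F N i by rewrite mnmE gez0_abs.
exists (frac _ (quot_pi I (c *: 'X_[m])) N).
  exists (quot_pi I (c *: 'X_[m])), N; split=> //; exists (c *: 'X_[m]) => //.
  move=> m' /msuppZ_le; rewrite msuppX inE => /eqP ->.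
  by rewrite -sum_shift mdeg_int; apply: eq_bigr.
move=> a'; rewrite lcoefE; case: eqP => [->|ne].
  by case: asboolP => // _; rewrite (zcoef_mnm _ em) mcoeffZ mcoeffX eqxx mulr1.
case: ifP => // _; apply/eqP/negPn/negP => /zcoef_neq0[m' + em'].
move/msuppZ_le; rewrite msuppX inE => /eqP e; apply: ne; apply/ffunP=> i.
by have := em i; rewrite -e em'; apply: addIr.
Qed.

(** The coefficients at finitely many exponents can be prescribed freely. *)
Lemma exists_lcoef (A : seq {ffun 'I_n -> int}) F t
    (p : {ffun 'I_n -> int} -> K) :
  uniq A -> {in A, forall a, \sum_i a i = t} ->
  exists2 u : loc M (xprod K F), loc_gr gr t u &
    forall a, face I a F -> lcoef a u = if a \in A then p a else 0.
Proof.
elim: A => [|a A IH] /= => [_ _|/andP[aA uA] At].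
  by exists 0; [exact: loc_gr0 | move=> a; rewrite raddf0].
have [a' a'A|u ut uA'] := IH uA; first by apply: At; rewrite inE a'A orbT.
have [aF|naF] := pselect (face I a F); last first.
  exists u => // a' a'F; rewrite inE uA' //; case: eqP => //= e.
  by case: naF; rewrite -e.
have [v vt vE] := exists_monomial (p a) aF.
exists (v + u); first by apply: loc_grD => //; rewrite -(At a) ?mem_head.
move=> a' a'F; rewrite raddfD /= vE uA' // inE; case: eqP => [->|_] /=.
  by rewrite (negbTE aA) addr0.
by rewrite add0r.
Qed.

(** At a face [G], the maps from the localizations at the [G :\ j] do not change
    coefficients: if [G :\ j] is not a face then, [G] being one, [a j] is
    negative, so the coefficient at [a] is zero before and after. *)
Lemma lcoef_diff a (c : cochain M) G : face I a G ->
  lcoef a (cech_diff c G) = comb_diff (fun F => lcoef a (c F)) G.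
Proof.
move=> aG; rewrite /comb_diff raddf_sum; apply: eq_bigr => j jG.
rewrite raddfMz -/(comb_sign G j); apply: (congr1 (fun x => x *~ _)) => /=.
have [[f k] /= ->] := frac_pi_surj (c (G :\ j)).
have eG : xprod K G = 'X_j * xprod K (G :\ j).
  by rewrite /xprod (big_setD1 j).
rewrite (loc_mapE eG) quot_piZ !lcoefE; case: asboolP => // _.
have e i : shift a G k i = shift a (G :\ j) k i + ((U_(j) *+ k)%MM i)%:Z.
  rewrite /shift mulmnE mnmE !inE [i == j]eq_sym.
  case: (eqVneq j i) => [<-|_]; rewrite ?jG; last case: (i \in G); lia.
rewrite mpolyXn (zcoefMX _ e); case: asboolP => // naG.
apply/eqP/negPn/negP => /zcoef_neq0[m _ em]; apply: naG; split=> [i|N m' em'].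
  have := em i; rewrite /shift => + iG; rewrite (negbTE iG); lia.
have eX : 'X_[m' + U_(j) *+ N] \notin I.
  apply: (proj2 aG N) => i.
  rewrite mnmDE PoszD em' /shift mulmnE mnmE !inE [i == j]eq_sym.
  case: (eqVneq j i) => [<-|_]; rewrite ?jG; last case: (i \in G); lia.
by apply: contra eX => m'I; rewrite mpolyXD mulrC idealM.
Qed.

End Multigraded.

Section Decomposition.

Variables (K : fieldType) (n : nat) (I : ideal {mpoly K[n]}).
Implicit Types (a : {ffun 'I_n -> int}) (E F G : {set 'I_n}).
Hypothesis I_mon : monomial_closed I.
Local Notation M := (quotmod I).
Local Notation gr := (@quot_gr K n I).

Lemma lcoef_fin (F : {set 'I_n}) (u : loc M (xprod K F)) :
  exists A : seq {ffun 'I_n -> int}, forall a, lcoef a u != 0 -> a \in A.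
Proof.
have [[f k] /= ->] := frac_pi_surj u.
exists [seq [ffun i => (m i)%:Z - (k * (i \in F))%N%:Z]
  | m : 'X_{1..n} <- msupp f] => a.
rewrite lcoefE //; case: ifP => _; last by rewrite eqxx.
move=> /zcoef_neq0[m mf em]; apply/mapP; exists m => //.
by apply/ffunP=> i; rewrite ffunE em /shift addrK.
Qed.

(** One cocycle has coefficients at finitely many exponents only.  So if it is a
    coboundary at each of them, the finitely many primitives add up to a
    primitive, which is how the infinite direct sum over [a] is handled. *)
Lemma cech_multigraded i t :
  loc_coh_neq0 gr i t <->
  exists2 a : {ffun 'I_n -> int}, \sum_i a i = t & comb_neq0 K (face I a) i.
Proof.
split=> [[c [ct cc ncb]]|[a at_ [p [pD pc npb]]]].
  apply: contrapT => na; apply: ncb.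
  have bnd (a : {ffun 'I_n -> int}) : \sum_i a i = t ->
      comb_bound (face I a) i (fun F => lcoef a (c F)).
    move=> at_; apply: contrapT => nb; apply: na; exists a => //.
    exists (fun F => lcoef a (c F)); split=> // [F _|G Gi aG].
      exact: lcoef_nface.
    by rewrite -lcoef_diff // cc // raddf0.
  have [A AP] : exists A : seq {ffun 'I_n -> int},
      forall (F : {set 'I_n}) a, lcoef a (c F) != 0 -> a \in A.
    have /choice[AF AFP] F := lcoef_fin (c F).
    exists (flatten [seq AF F | F <- enum {set 'I_n}]) => F a /AFP aF.
    by apply/flattenP; exists (AF F) => //; apply: map_f; rewrite mem_enum.
  pose A' := undup [seq a : {ffun 'I_n -> int} <- A | \sum_i a i == t].
  have A't : {in A', forall a, \sum_i a i = t}.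
    by move=> a; rewrite mem_undup mem_filter => /andP[/eqP].
  have /choice[q qP] (a : {ffun 'I_n -> int}) : exists q : {set 'I_n} -> K,
      \sum_i a i = t ->
      (forall E, #|E|.+1 = i -> ~ face I a E -> q E = 0) /\
      (forall F, #|F| = i -> face I a F -> lcoef a (c F) = comb_diff q F).
    have [/bnd[q ?]|nt] := pselect (\sum_i a i = t); first by exists q.
    by exists (fun=> 0).
  have exE (E : {set 'I_n}) : exists u : loc M (xprod K E),
      loc_gr gr t u /\
      forall a, face I a E -> lcoef a u = if a \in A' then q a E else 0.
    have [u ut uE] := exists_lcoef I_mon E (q^~ E) (undup_uniq _) A't.
    by exists u.
  pose b E := projT1 (cid (exE E)).
  have bt E : loc_gr gr t (b E) by have [] := projT2 (cid (exE E)).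
  have bE E a : face I a E -> lcoef a (b E) = if a \in A' then q a E else 0.
    by have [_] := projT2 (cid (exE E)); apply.
  exists b; split=> // F Fi; apply: lcoef_inj => // a.
  have [aF|naF] := pselect (face I a F); last by rewrite !lcoef_nface.
  rewrite lcoef_diff //; case: (boolP (a \in A')) => aA.
    have [q0 qd] := qP a (A't a aA); rewrite qd //.
    apply: eq_bigr => j jF; apply: (congr1 (fun x => x *~ _)).
    have [aFj|naFj] := pselect (face I a (F :\ j)); first by rewrite bE // aA.
    rewrite q0 // ?lcoef_nface // -Fi; first by rewrite (cardsD1 j F) jF.
  have -> : lcoef a (c F) = 0.
    apply/eqP/negPn/negP => /[dup] /AP aA' /(lcoef_homog I_mon (ct F Fi)) at_.
    by case/negP: aA; rewrite mem_undup mem_filter at_ eqxx.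
  rewrite /comb_diff big1 // => j jF.
  have [aFj|naFj] := pselect (face I a (F :\ j)); last first.
    by rewrite lcoef_nface ?mul0rz.
  by rewrite bE // (negbTE aA) mul0rz.
have ex (F : {set 'I_n}) : exists u : loc M (xprod K F), loc_gr gr t u /\
    forall a', lcoef a' u = if (a' == a) && `[< face I a F >] then p F else 0.
  case: asboolP => [aF|naF].
    have [u ut uE] := exists_monomial I_mon (p F) aF.
    by exists u; rewrite -at_; split=> // a'; rewrite andbT.
  by exists 0; split=> [|a']; rewrite ?andbF ?raddf0 //; apply: loc_gr0.
pose c F := projT1 (cid (ex F)).
have ct F : loc_gr gr t (c F) by have [] := projT2 (cid (ex F)).
have cE F a' :
    lcoef a' (c F) = if (a' == a) && `[< face I a F >] then p F else 0.
  by have [_] := projT2 (cid (ex F)); apply.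
have cpE (F : {set 'I_n}) : #|F| = i -> lcoef a (c F) = p F.
  by move=> Fi; rewrite cE eqxx; case: asboolP => //= aF; rewrite pD.
exists c; split=> [F _ //|G Gi|[b [bt bd]]].
  apply: lcoef_inj => // a'; rewrite lcoef0 //.
  have [aG|naG] := pselect (face I a' G); last by rewrite lcoef_nface.
  rewrite lcoef_diff //; have [e|ne] := eqVneq a' a.
    rewrite -(pc G Gi) -?e //; apply: eq_bigr => j jG; rewrite e cpE //.
    by move: Gi; rewrite (cardsD1 j G) jG => -[].
  by rewrite /comb_diff big1 // => j jG; rewrite cE (negbTE ne) mul0rz.
apply: npb; exists (fun E => lcoef a (b E)); split=> [E _|F Fi aF].
  exact: lcoef_nface.
by rewrite -lcoef_diff // -bd // cpE.
Qed.

End Decomposition.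

(** * Adding a variable to a combinatorial Cech complex *)

Section Transfer.
Variables (K : fieldType) (r : nat).
Implicit Types (F : {set 'I_r}) (G : {set 'I_r.+1}).
Local Notation widen := (widen_ord (leqnSn r)).
Local Notation y := (@ord_max r).

Definition wset F : {set 'I_r.+1} := [set widen i | i in F].
Definition uset G : {set 'I_r} := [set i | widen i \in G].

Lemma widen_inj : injective widen.
Proof. by move=> i j [/val_inj]. Qed.

Lemma widen_neq_max i : (widen i == y) = false.
Proof. by rewrite -val_eqE /= ltn_eqF. Qed.

Lemma ord_maxP (i : 'I_r.+1) : i = y \/ exists j, i = widen j.
Proof.
case: (unliftP y i) => [j ->|->]; [right; exists j | by left].
by apply: val_inj; rewrite /= /bump leqNgt ltn_ord.
Qed.

Lemma mem_wset F i : (widen i \in wset F) = (i \in F).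
Proof. exact: (mem_imset _ _ widen_inj). Qed.

Lemma max_wset F : (y \in wset F) = false.
Proof. by apply/imsetP => -[i _ /eqP]; rewrite eq_sym widen_neq_max. Qed.

Lemma card_wset F : #|wset F| = #|F|.
Proof. exact: card_imset widen_inj. Qed.

Lemma usetK F : uset (wset F) = F.
Proof. by apply/setP=> i; rewrite inE mem_wset. Qed.

Lemma wsetK G : y \notin G -> wset (uset G) = G.
Proof.
move=> yG; apply/setP=> i; case: (ord_maxP i) => [->|[j ->]].
  by rewrite max_wset (negbTE yG).
by rewrite mem_wset inE.
Qed.

Lemma wset0 : wset set0 = set0. Proof. exact: imset0. Qed.

Lemma wset_setD1 F j : wset F :\ widen j = wset (F :\ j).
Proof.
apply/setP=> i; rewrite !inE; case: (ord_maxP i) => [->|[k ->]].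
  by rewrite !max_wset andbF.
by rewrite !mem_wset !inE (inj_eq widen_inj).
Qed.

Lemma comb_sign_wset F j : comb_sign (wset F) (widen j) = comb_sign F j.
Proof.
rewrite /comb_sign -[in RHS]card_wset; congr (_ ^+ #|pred_of_set _|).
apply/setP=> i; rewrite inE; case: (ord_maxP i) => [->|[k ->]].
  by rewrite !max_wset.
by rewrite !mem_wset !inE.
Qed.

Lemma comb_diff_wset (p : {set 'I_r.+1} -> K) F :
  comb_diff p (wset F) = comb_diff (p \o wset) F.
Proof.
rewrite /comb_diff big_imset => [|? ? _ _ /widen_inj //]; apply: eq_bigr => j _.
by rewrite comb_sign_wset wset_setD1.
Qed.

Definition ext0 (p : {set 'I_r} -> K) G : K :=
  if y \in G then 0 else p (uset G).

Lemma ext0_wset p : ext0 p \o wset =1 p.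
Proof. by move=> F; rewrite /ext0 /= max_wset usetK. Qed.

Variables (DS : {set 'I_r} -> Prop) (DR : {set 'I_r.+1} -> Prop).
Hypothesis DRS : forall F, F != set0 -> DR (wset F) <-> DS F.
Hypothesis DS0 : DS set0 -> DR set0.
Hypothesis DRy : forall G, y \in G -> (1 < #|G|)%N -> ~ DR G.

(** A cocycle is extended by zero to the sets that contain y.  If the extension
    bounds, a primitive restricts; the restriction is still supported on [DS],
    except that the empty set may be a face for [DR] only, and the hypothesis on
    the empty set rules out cohomology in that case. *)
Lemma comb_neq0_extend i : (0 < i)%N ->
  (DR set0 -> ~ DS set0 -> forall F, ~ DS F) ->
  comb_neq0 K DS i -> comb_neq0 K DR i.
Proof.
move=> i0 DR0 [p [p0 pd pb]].
exists (ext0 p); split=> [G Gi nG|G Gi DG|[q [q0 qd]]].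
- rewrite /ext0; case: ifPn => // yG.
  apply: p0; first by rewrite -card_wset wsetK.
  rewrite -DRS ?wsetK //; apply: contraTneq i0 => e.
  by rewrite -Gi -(wsetK yG) e wset0 cards0.
- have yG : y \notin G by apply/negP=> /DRy; apply => //; rewrite Gi.
  rewrite -(wsetK yG) comb_diff_wset (eq_comb_diff _ (ext0_wset p)).
  apply: pd; first by rewrite -card_wset wsetK.
  rewrite -DRS ?wsetK //; apply: contra_eq_neq Gi => e.
  by rewrite -(wsetK yG) e wset0 cards0.
- apply: pb; have [[DR0' nDS0]|n0] := pselect (DR set0 /\ ~ DS set0).
    by exists (fun=> 0); split=> // F _ /(DR0 DR0' nDS0).
  exists (q \o wset); split=> [E Ei nE|F Fi DF] /=.
    apply: q0; first by rewrite card_wset.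
    have [e|/DRS -> //] := eqVneq E set0; rewrite e wset0 => DR0'.
    by apply: n0; split; rewrite // -e.
  rewrite -comb_diff_wset -qd ?card_wset //; first exact/esym/ext0_wset.
  by rewrite DRS // -card_gt0 Fi.
Qed.

(** Here a cocycle is restricted to the sets without y.  Nothing is lost if its
    degree leaves no room for a face containing y. *)
Lemma comb_neq0_restrict i : (0 < i)%N -> (1 < i)%N \/ ~ DR [set y] ->
  comb_neq0 K DR i -> comb_neq0 K DS i.
Proof.
move=> i0 iy [p [p0 pd pb]].
have ne F : (0 < #|F|)%N -> DR (wset F) <-> DS F.
  by rewrite card_gt0; apply: DRS.
exists (p \o wset); split=> [F Fi nF|F Fi DF|[q [q0 qd]]] /=.
- by apply: p0; rewrite ?card_wset // ne ?Fi.
- by rewrite -comb_diff_wset pd ?card_wset // ne ?Fi.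
apply: pb; exists (ext0 q); split=> [E Ei nE|G Gi DG].
  rewrite /ext0; case: ifPn => // yE.
  apply: q0; first by rewrite -card_wset wsetK.
  have [e|/DRS <-] := eqVneq (uset E) set0; last by rewrite wsetK.
  by rewrite e => /DS0; rewrite -wset0 -e wsetK.
have yG : y \notin G.
  apply/negP => yG; case: (ltnP 1 i) => i1.
    by apply: DRy DG => //; rewrite Gi.
  case: iy; first lia; apply; suff <- : G = [set y] by [].
  apply/eqP; rewrite eq_sym eqEcard sub1set yG cards1 Gi; lia.
rewrite -(wsetK yG) comb_diff_wset (eq_comb_diff _ (ext0_wset q)) -qd //.
  by rewrite -card_wset wsetK.
by rewrite -ne ?wsetK // -card_wset wsetK ?Gi.
Qed.

End Transfer.

(** * Faces of the powers of J *)

Section FacesJ.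
Variables (K : fieldType) (r : nat) (I : ideal {mpoly K[r]}).
Hypothesis I_mon : monomial_closed I.
Hypothesis I_proper : exists f, f \notin I.
Local Notation J := (idealJ I).
Local Notation widen := (widen_ord (leqnSn r)).
Local Notation y := (@ord_max r).
Implicit Types (F : {set 'I_r}) (G : {set 'I_r.+1}) (a : {ffun 'I_r.+1 -> int}).
Implicit Types (m : 'X_{1..r}) (M : 'X_{1..r.+1}).

Definition ares a : {ffun 'I_r -> int} := [ffun i => a (widen i)].

Lemma sum_ares a : \sum_i a i = \sum_i ares a i + a y.
Proof.
by rewrite big_ord_recr; congr (_ + _); apply: eq_bigr => i _; rewrite ffunE.
Qed.

Lemma shift_wset a F N i : shift a (wset F) N (widen i) = shift (ares a) F N i.
Proof. by rewrite /shift mem_wset ffunE. Qed.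

Lemma shift_notin n (a : {ffun 'I_n -> int}) (G' : {set 'I_n}) N i :
  i \notin G' -> shift a G' N i = a i.
Proof. by rewrite /shift => /negbTE ->; rewrite muln0 addr0. Qed.

Lemma face_nonneg n (I' : ideal {mpoly K[n]}) (a : {ffun 'I_n -> int})
    (F' : {set 'I_n}) :
  face I' a F' -> exists N, forall N', (N <= N')%N -> forall i,
    0 <= shift a F' N' i /\ (i \in F' -> (N' - N)%N%:Z <= shift a F' N' i).
Proof.
move=> [a0 _]; exists (\sum_i `|a i|)%N => N NN' i.
have : (`|a i| <= \sum_i `|a i|)%N by rewrite (bigD1 i) //= leq_addr.
rewrite /shift; move: (\sum_i _)%N NN' (a0 i) => S NS.
case: (i \in F') => /= [_|/(_ isT) ai _]; split=> //; lia.
Qed.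

(** J^n contains m^n y^n.  So at a face, multiplication by powers of the
    localized variables cannot bring both the y-exponent and the total
    x-degree up to [n]. *)
Lemma face_torsion n a G : face (ideal_pow J n) a G ->
  y \in G \/ n%:Z <= a y ->
  (exists j, widen j \in G) \/ n%:Z <= \sum_i ares a i -> False.
Proof.
move=> aG yn jn; have [N0 NP] := face_nonneg aG; pose N := (N0 + n)%N.
have {}NP := NP N (leq_addr _ _).
pose M := [multinom `|shift a G N i|%N | i < r.+1].
have eM i : (M i)%:Z = shift a G N i by rewrite mnmE gez0_abs //; case: (NP i).
have := proj2 aG N M eM.
rewrite -[n]addn0 (@Jpow_mem _ _ _ I_mon n 0 0%MM (mres M)) //.
- exact: ideal_pow0.
- rewrite -lez_nat mdeg_int; have eR i : (mres M i)%:Z = shift a G N (widen i).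
    by rewrite -eM mnmE.
  rewrite (eq_bigr _ (fun i _ => eR i)); case: jn => [[j jG]|jn].
    rewrite (bigD1 j) //= -[n%:Z]addr0; apply: lerD.
      by have [_ /(_ jG)] := NP (widen j); rewrite addKn.
    by apply: sumr_ge0 => i _; case: (NP (widen i)).
  apply: le_trans jn _; apply: ler_sum => i _; rewrite ffunE /shift; lia.
- rewrite -lez_nat eM; case: yn => [yG|yn]; last by rewrite /shift; lia.
  by have [_ /(_ yG)] := NP y; rewrite addKn.
- by rewrite add0m.
Qed.

Lemma face_lift n k a F : a y = k%:Z ->
  face (ideal_pow I (n - k)) (ares a) F -> face (ideal_pow J n) a (wset F).
Proof.
move=> ak [a0 aF]; split=> [i|N M eM].
  case: (ord_maxP i) => [->|[j ->]]; first by rewrite ak.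
  by rewrite mem_wset => /a0; rewrite ffunE.
have My : M y = k by apply/eqP; rewrite -eqz_nat eM shift_notin ?max_wset // ak.
apply/negP => /(Jpow_res I_mon); rewrite My; apply/negP.
by apply: (aF N) => i; rewrite mnmE eM shift_wset.
Qed.

(** If x^a x_F^N were in I^(n - k), then x^a x_F^(N + k) y^k would be in J^n,
    since x_F^k lies in m^k for a nonempty [F]. *)
Lemma face_drop n k a F : F != set0 -> a y = k%:Z -> (k <= n)%N ->
  face (ideal_pow J n) a (wset F) -> face (ideal_pow I (n - k)) (ares a) F.
Proof.
move=> F0 ak kn [a0 aF]; split=> [i iF|N m em].
  by rewrite ffunE; apply: a0; rewrite mem_wset.
apply/negP => mI; pose M := (mnmwiden (m + mnm_of_set F *+ k) + U_(y) *+ k)%MM.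
have My : M y = k by rewrite mnmDE mnmwiden_ordmax mulmnE mnm1E eqxx mul1n.
have eM : mres M = (m + mnm_of_set F *+ k)%MM.
  apply/mnmP=> i; rewrite [LHS]mnmE [LHS]mnmDE mnmwiden_widen mulmnE mnm1E.
  by rewrite eq_sym widen_neq_max addn0.
have /negP[] : 'X_[M] \notin ideal_pow J n.
  apply: (aF (N + k)%N) => i; case: (ord_maxP i) => [->|[j ->]].
    by rewrite My shift_notin ?max_wset.
  rewrite shift_wset shiftD -em -PoszD.
  by have /mnmP/(_ j) := eM; rewrite [LHS]mnmE [RHS]mnmDE => <-.
rewrite -(subnKC kn); apply: (Jpow_mem _ mI _ _ eM) => //; last by rewrite My.
by rewrite mdeg_mnm_of_set leq_pmulr // card_gt0.
Qed.

(** The hypotheses force x^a to be a monomial of I^(n - k), which therefore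
    vanishes in every localization of the quotient. *)
Lemma face_J_set0 n k a : a y = k%:Z -> face (ideal_pow J n) a set0 ->
  ~ face (ideal_pow I (n - k)) (ares a) set0 ->
  forall F, ~ face (ideal_pow I (n - k)) (ares a) F.
Proof.
move=> ak [a0 _] n0 F [_ aF]; apply: n0; split=> [i _|N m em].
  by rewrite ffunE a0 // inE.
apply: (aF 0%N) => i; rewrite em shift_notin ?inE //.
by rewrite /shift mul0n addr0.
Qed.

Lemma face_neg_y n a G : a y < 0 -> face (ideal_pow J n) a G -> y \in G.
Proof. by move=> ay [a0 _]; apply: contraLR ay => /a0; rewrite -leNgt. Qed.

Lemma card_gt1_widen G : (1 < #|G|)%N -> exists j, widen j \in G.
Proof.
move=> G1; apply: contrapT => nj; have : G \subset [set y].
  apply/subsetP=> i iG; rewrite inE; case: (ord_maxP i) => [->//|[j e]].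
  by case: nj; exists j; rewrite -e.
by move/subset_leq_card; rewrite cards1; lia.
Qed.

Lemma face_y_card n a G : y \in G -> (1 < #|G|)%N -> ~ face (ideal_pow J n) a G.
Proof.
by move=> yG /card_gt1_widen jG aG; apply: (face_torsion aG); left.
Qed.

Lemma comb_J_of_I n k a i : (0 < i)%N -> a y = k%:Z -> (k <= n)%N ->
  comb_neq0 K (face (ideal_pow I (n - k)) (ares a)) i ->
  comb_neq0 K (face (ideal_pow J n) a) i.
Proof.
move=> i0 ak kn; apply: comb_neq0_extend => // [F F0|G|].
- by split; [apply: face_drop | apply: face_lift].
- exact: face_y_card.
- exact: face_J_set0.
Qed.

Lemma comb_I_of_J n a i : (0 < i)%N ->
  (1 < i)%N \/ ~ face (ideal_pow J n) a [set y] ->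
  comb_neq0 K (face (ideal_pow J n) a) i ->
  exists k, [/\ (k < n)%N, a y = k%:Z &
    comb_neq0 K (face (ideal_pow I (n - k)) (ares a)) i].
Proof.
move=> i0 iy ci.
have [[k [ak kn]]|nk] := pselect (exists k, a y = k%:Z /\ (k < n)%N).
  exists k; split=> //; apply: comb_neq0_restrict iy ci => // [F F0|h|G].
  - by split; [apply: face_drop => //; apply: ltnW | apply: face_lift].
  - by rewrite -(wset0 r); apply: face_lift h.
  - exact: face_y_card.
(* With the y-exponent outside [0, n - 1] there are no nonempty faces without *)
(* y, and the complex is compared with that of the empty family.              *)
exfalso; apply: (@comb_neq0_empty K r (fun=> False) i) => [_ []|].
apply: (@comb_neq0_restrict K r (fun=> False)
  (face (ideal_pow J n) a)) iy ci => //.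
  move=> F F0; split=> // aF; have [ay|ay] := ltP (a y) 0.
    by have := face_neg_y ay aF; rewrite max_wset.
  apply: (face_torsion aF); last first.
    by left; have /set0Pn[j jF] := F0; exists j; rewrite mem_wset.
  right; rewrite leNgt; apply/negP => ayn; apply: nk; exists `|a y|%N.
  by rewrite gez0_abs //; lia.
exact: face_y_card.
Qed.

Lemma face_y_bounds n a : face (ideal_pow J n) a [set y] ->
  (forall i, 0 <= ares a i) /\ \sum_i ares a i < n%:Z.
Proof.
move=> aG; split=> [i|].
  by rewrite ffunE; apply: (proj1 aG); rewrite inE widen_neq_max.
rewrite ltNge; apply/negP => h; apply: (face_torsion aG); last by right.
by left; rewrite inE.
Qed.

Lemma face_small n a G : (forall i, i \notin G -> 0 <= a i) ->
  \sum_i ares a i < n%:Z -> G \subset [set y] -> face (ideal_pow J n) a G.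
Proof.
move=> a0 an Gy; split=> // N M eM; apply/negP => /(Jpow_mdeg I_mon I_proper).
rewrite -lez_nat mdeg_int leNgt (eq_bigr (ares a)) ?an // => i _.
rewrite mnmE eM shift_notin ?ffunE //.
by apply: contraFN (widen_neq_max i) => /(subsetP Gy); rewrite inE.
Qed.

(** The x-part of the exponent has degree at most n - 1, and so does the y-part b:
    for b >= n no singleton other than {y} is a face, whereas the empty set is
    one, and its coboundary accounts for {y}. *)
Lemma comb1_degree_le n a : face (ideal_pow J n) a [set y] ->
  comb_neq0 K (face (ideal_pow J n) a) 1 -> \sum_i a i <= (2 * n - 2)%N%:Z.
Proof.
move=> ay [p [p0 pd pb]]; have [a0 an] := face_y_bounds ay.
have [ayn|nay] := ltP (a y) n%:Z; first by rewrite sum_ares; lia.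
case: pb; exists (fun=> p [set y]); split=> [E [] /eqP|F /eqP/cards1P[x ->] Fx].
  rewrite cards_eq0 => /eqP -> [].
  apply: face_small; rewrite ?sub0set // => i _.
  by case: (ord_maxP i) => [->|[j ->]]; [lia | have := a0 j; rewrite ffunE].
rewrite comb_diff_set1; case: (ord_maxP x) => [->//|[j e]].
case: (face_torsion Fx); first by right.
by left; exists j; rewrite e inE.
Qed.

Lemma ideal_pow1 m : 'X_[m] \in ideal_pow I 1 -> 'X_[m] \in I.
Proof.
move=> h; suff [] : 1%N = 0%N \/ 'X_[m] \in I by [].
apply: (@ideal_pow_supp _ _ I (fun k m => k = 0%N \/ 'X_[m] \in I)
  _ _ _ 1 'X_[m] m h).
- by move=> k m1 m2 [|h1]; [left | right; rewrite mpolyXD mulrC idealM].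
- by left.
- by move=> f k m1 m2 /I_mon fI /fI h1 _; right; rewrite mpolyXD mulrC idealM.
- by rewrite msuppX mem_head.
Qed.

(** At ((n - 1) e_j, n - 1) the indicator function of {y} is a cocycle, because
    {y, x_k} is never a face.  It does not bound: the coboundary of a function
    on the empty set takes the same value on the faces {y} and {x_j}. *)
Lemma comb1_top n j : (0 < n)%N -> (forall k, 'X_[U_(j) *+ k] \notin I) ->
  exists2 a : {ffun 'I_r.+1 -> int}, \sum_i a i = (2 * n - 2)%N%:Z &
    comb_neq0 K (face (ideal_pow J n) a) 1.
Proof.
move=> n0 jI; pose a : {ffun 'I_r.+1 -> int} :=
  [ffun i => if (i == y) || (i == widen j) then n.-1%:Z else 0].
have ay : a y = n.-1%:Z by rewrite ffunE eqxx.
have aE i : ares a i = if i == j then n.-1%:Z else 0.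
  by rewrite !ffunE widen_neq_max (inj_eq (@widen_inj r)).
have a0 i : 0 <= a i by rewrite ffunE; case: ifP.
have sa : \sum_i ares a i = n.-1%:Z.
  rewrite (bigD1 j) //= big1 ?aE ?eqxx ?addr0 // => i /negbTE ij.
  by rewrite aE ij.
exists a; first by rewrite sum_ares sa ay; lia.
exists (fun G => (G == [set y])%:R); split=> [G _ nG|G Gi DG|[q [_ qd]]].
- case: eqP => // e; case: nG; rewrite e; apply: face_small => //.
  by rewrite sa ltz_nat prednK.
- rewrite /comb_diff big1 // => x xG.
  case: eqP => [e|_]; last by rewrite mul0rz.
  case: (face_y_card _ _ DG); last by rewrite Gi.
  have : y \in G :\ x by rewrite e set11.
  by rewrite !inE => /andP[].
have qj : face (ideal_pow J n) a [set widen j].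
  have -> : [set widen j] = wset [set j] by rewrite /wset imset_set1.
  apply: (face_lift ay); have -> : (n - n.-1 = 1)%N by lia.
  split=> [i _|N m em]; first by rewrite ffunE.
  apply/negP => /ideal_pow1; apply/negP.
  suff -> : m = (U_(j) *+ (n.-1 + N))%MM by [].
  apply/mnmP=> i; apply/eqP.
  rewrite -eqz_nat em mulmnE mnm1E /shift aE inE [i == j]eq_sym.
  by case: (j == i); apply/eqP; lia.
have q1 : q set0 = 1.
  rewrite -(comb_diff_set1 q y) -qd ?cards1 ?eqxx //.
  by apply: face_small => //; rewrite sa ltz_nat prednK.
have : q set0 = 0.
  rewrite -(comb_diff_set1 q (widen j)) -qd ?cards1 //.
  by rewrite (inj_eq set1_inj) widen_neq_max.
by move/eqP; rewrite q1 oner_eq0.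
Qed.

End FacesJ.

(** * Local cohomology of the powers of J *)

(** If x_j^k is in I, then 1 is in I[j], being the image of x_j^k. *)
Lemma subst1_surj (K : fieldType) (r : nat) (I : ideal {mpoly K[r]})
    (j : 'I_r) k :
  'X_[U_(j) *+ k] \in I -> forall g, monomial_loc I j g.
Proof.
move=> jI g; pose h := g \mPo [tuple 'X_(lift j i) : {mpoly K[r]} | i < r.-1].
exists ('X_[U_(j) *+ k] * h); first by rewrite mulrC idealM.
rewrite /subst1 rmorphM /= -mpolyXn rmorphXn /= comp_mpolyXU.
rewrite -tnth_nth tnth_mktuple unlift_none expr1n mul1r /h.
elim/mpolyind: g {h} => [|c m p _ _ IH]; first by rewrite !comp_mpoly0.
rewrite !comp_mpolyD -IH !comp_mpolyZ; congr (_ *: _ + _).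
rewrite comp_mpolyX rmorph_prod /= mpolyXE_id; apply: eq_bigr => i _.
by rewrite rmorphXn /= tnth_mktuple comp_mpolyXU -tnth_nth tnth_mktuple liftK.
Qed.

Section Main.
Variables (K : fieldType) (r : nat) (I : ideal {mpoly K[r]}).
Hypothesis I_mon : monomial_ideal I.
Hypothesis I_proper : exists f, f \notin I.
Variables (n : nat).

Let cI := monomial_ideal_closed I_mon.
Let cP k : monomial_closed (ideal_pow I k) := monomial_closed_pow cI.
Let cJ : monomial_closed (ideal_pow (idealJ I) n) :=
  monomial_closed_pow (monomial_closed_idealJ cI).

(** The set of degrees in which the direct sum of the [i]-th local cohomology of
    the S / I^(n - t), each shifted by [t], is nonzero. *)
Definition coh_sum i d := exists t : 'I_n,
  loc_coh_neq0 (@quot_gr K r (ideal_pow I (n - t))) i (d - t%:Z).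

Lemma zmax_coh_sum i : zmax (coh_sum i) =
  (\big[maxe/-oo]_(t < n) (a_quot i (ideal_pow I (n - t)) + t%:Z%:E))%E.
Proof. by rewrite zmax_bigU; apply: eq_bigr => t _; rewrite zmax_shift. Qed.

Lemma coh_sum_J i d : (0 < i)%N ->
  coh_sum i d -> loc_coh_neq0 (@quot_gr K r.+1 (ideal_pow (idealJ I) n)) i d.
Proof.
move=> i0 [t /(cech_multigraded (@cP _)) [a ea ca]].
apply/(cech_multigraded cJ).
pose a' : {ffun 'I_r.+1 -> int} :=
  [ffun i => if unlift ord_max i is Some j then a j else t%:Z].
have ay : a' ord_max = t%:Z by rewrite ffunE unlift_none.
have ea' : ares a' = a.
  apply/ffunP=> j; rewrite !ffunE.
  have -> : widen_ord (leqnSn r) j = lift ord_max j.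
    by apply: val_inj; rewrite /= /bump leqNgt ltn_ord.
  by rewrite liftK.
exists a'; first by rewrite sum_ares ea' ea ay subrK.
by apply: (comb_J_of_I cI i0 ay) => //; rewrite ?ea' // ltnW.
Qed.

Lemma coh_J_sum i d : (1 < i)%N ->
  loc_coh_neq0 (@quot_gr K r.+1 (ideal_pow (idealJ I) n)) i d -> coh_sum i d.
Proof.
move=> i1 /(cech_multigraded cJ) [a ea ca].
have [|k [kn ak ck]] := comb_I_of_J cI (ltnW i1) _ ca; first by left.
exists (Ordinal kn); apply/(cech_multigraded (@cP _)); exists (ares a) => //=.
by rewrite -ea sum_ares ak addrK.
Qed.

Lemma coh1_J_sum d :
  loc_coh_neq0 (@quot_gr K r.+1 (ideal_pow (idealJ I) n)) 1 d ->
  d <= (2 * n - 2)%N%:Z \/ coh_sum 1 d.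
Proof.
move=> /(cech_multigraded cJ) [a ea ca].
have [ay|nay] := pselect (face (ideal_pow (idealJ I) n) a [set ord_max]).
  by left; rewrite -ea; apply: comb1_degree_le ca.
have [//||k [kn ak ck]] := comb_I_of_J cI _ _ ca; first by right.
right; exists (Ordinal kn); apply/(cech_multigraded (@cP _)).
by exists (ares a); rewrite //= -ea sum_ares ak addrK.
Qed.

End Main.

Theorem theorem2p8 (K : fieldType) (r : nat) (I : ideal {mpoly K[r]})
    (I_mon : monomial_ideal I) (I_proper : exists f, f \notin I)
    (n : nat) (n_ge1 : (1 <= n)%N) :
  (forall i : nat, (2 <= i)%N ->
     a_quot i (ideal_pow (idealJ I) n) =
     \big[maxe/-oo]_(t < n) (a_quot i (ideal_pow I (n - t)) + t%:Z%:E))%E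
  /\
  ((exists j : 'I_r, exists g, ~ monomial_loc I j g) ->
     a_quot 1 (ideal_pow (idealJ I) n) =
     maxe ((2 * n - 2)%N%:Z)%:E
       (\big[maxe/-oo]_(t < n) (a_quot 1 (ideal_pow I (n - t)) + t%:Z%:E)))%E.
Proof.
split=> [i i2|[j [g jg]]].
  rewrite -zmax_coh_sum; apply: zmax_ext => d; split; first exact: coh_J_sum.
  by apply: coh_sum_J => //; apply: ltnW.
have jI k : 'X_[U_(j) *+ k] \notin I.
  by apply/negP => /subst1_surj /(_ g).
rewrite -zmax_coh_sum; apply/eqP; rewrite eq_le; apply/andP; split.
  apply/zmax_leP => d /(coh1_J_sum I_mon I_proper) [le|/zmax_ub h].
    by rewrite le_max lee_fin le.
  by rewrite le_max h orbT.
have cI := monomial_ideal_closed I_mon.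
rewrite ge_max; apply/andP; split; last first.
  by apply/zmax_leP => d /(coh_sum_J I_mon)/zmax_ub; apply.
have [a <- ca] := comb1_top cI I_proper n_ge1 jI.
apply: zmax_ub; apply/cech_multigraded; last by exists a.
exact: monomial_closed_pow (monomial_closed_idealJ cI).
Qed.
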